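(* Let $\sigma^2>0$ (with $\sigma>0$), let $P_X$ be a distribution on $\mathbb{R}^d$, let $\phi^r:\mathbb{R}^d\to\mathbb{R}^r$ be a feature map, let $L\in\mathbb{R}^{r\times r}$ be a fixed matrix and $\phi^L(x):=L^\top\phi^r(x)$. Assume $\|\phi^L(x)\|_2\le K$ for all $x$ (training and test points) and that $\Sigma:=\mathbb{E}_{x\sim P_X}[\phi^L(x)\phi^L(x)^\top]$ satisfies $\lambda_{\min}(\Sigma)>0$. Let $\delta>0$ and $N\ge k\ge\frac83\log\left(\frac{4r}{\delta}\right)\left(\frac{4K^2}{\lambda_{\min}(\Sigma)}\right)^2$. Let $\mathbf{x}_1,\ldots,\mathbf{x}_N\sim P_X$ be i.i.d. and $s_1,\ldots,s_k\in\{1,\ldots,N\}$ drawn uniformly without replacement; define $\hat\Sigma_N:=\frac1N\sum_{i=1}^N\phi^L(\mathbf{x}_i)\phi^L(\mathbf{x}_i)^\top$ and $\hat\Sigma_k:=\frac1k\sum_{i=1}^k\phi^L(\mathbf{x}_{s_i})\phi^L(\mathbf{x}_{s_i})^\top$. For test points $\mathbf{x}'_1,\ldots,\mathbf{x}'_{N'}$ let $\Phi^L_{\mathbf{x}'}$ have rows $\phi^L(\mathbf{x}'_i)^\top$ and define $$S^B_{\mathbf{x}',\mathbf{x}'}:=\Phi^L_{\mathbf{x}'}\Big(\tfrac{1}{\sigma^2}N\hat\Sigma_N+I_r\Big)^{-1}\Phi^{L\top}_{\mathbf{x}'},\qquad S^{B,k}_{\mathbf{x}',\mathbf{x}'}:=\Phi^L_{\mathbf{x}'}\Big(\tfrac{1}{\sigma^2}N\hat\Sigma_k+I_r\Big)^{-1}\Phi^{L\top}_{\mathbf{x}'}.$$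 Then with probability at least $1-\delta$, for any $N'$ test points $\mathbf{x}'_1,\ldots,\mathbf{x}'_{N'}$, $$\big\|S^{B,k}_{\mathbf{x}',\mathbf{x}'}-S^B_{\mathbf{x}',\mathbf{x}'}\big\|_2\le N'\,\frac{4K^4}{\left(\sigma/N+\sigma^{-1}\lambda_{\min}(\Sigma)/2\right)^2}\,\frac1N\sqrt{\frac{8}{3k}\log(4r/\delta)}.$$
   Context: $\|\cdot\|_2$ is the spectral norm and $\lambda_{\min}$ the smallest eigenvalue. $S^B$ is the full-data predictive covariance with features $\phi^L$ and noise variance $\sigma^2$; $S^{B,k}$ is its subsampled approximation. *)

(* Defs.v *)
From HB Require Import structures.
From mathcomp Require Import all_boot all_order all_algebra.
From mathcomp Require Import all_classical all_reals all_analysis.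
Set Implicit Arguments. Unset Strict Implicit. Unset Printing Implicit Defensive.
Import Order.TTheory GRing.Theory Num.Theory.
Import numFieldNormedType.Exports.
Local Open Scope classical_set_scope.
Local Open Scope ring_scope.

Definition Rd (R : realType) (d : nat) : Type :=
  g_sigma_algebraType (@open 'rV[R]_d).

Definition vnorm2 (R : realType) (n : nat) (v : 'cV[R]_n) : R :=
  Num.sqrt (\sum_(i < n) v i 0 ^+ 2).

Definition spec_norm (R : realType) (m n : nat) (A : 'M[R]_(m, n)) : R :=
  sup [set vnorm2 (A *m v) | v in [set v : 'cV[R]_n | vnorm2 v = 1]].

Definition lambda_min (R : realType) (n : nat) (A : 'M[R]_n) : R :=
  inf [set a : R | eigenvalue A a].

Definition phiL (R : realType) (T : Type) (r : nat)
  (L : 'M[R]_r) (phi : T -> 'cV[R]_r) (x : T) : 'cV[R]_r :=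
  L^T *m phi x.

Definition second_moment (R : realType) (dT : measure_display)
  (T : measurableType dT) (PX : probability T R) (r : nat)
  (f : T -> 'cV[R]_r) : 'M[R]_r :=
  \matrix_(i < r, j < r) (\int[PX]_x (f x i 0 * f x j 0)).

Definition emp_cov (R : realType) (T : Type) (r n : nat)
  (f : T -> 'cV[R]_r) (xs : 'I_n -> T) : 'M[R]_r :=
  n%:R^-1 *: \sum_(i < n) (f (xs i) *m (f (xs i))^T).

Definition feat_mx (R : realType) (T : Type) (r N' : nat)
  (f : T -> 'cV[R]_r) (xs : 'I_N' -> T) : 'M[R]_(N', r) :=
  \matrix_(i < N', j < r) f (xs i) j 0.

Definition pred_cov (R : realType) (r N' : nat) (N : nat) (sigma : R)
  (Phi : 'M[R]_(N', r)) (Sig : 'M[R]_r) : 'M[R]_N' :=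
  Phi *m invmx ((N%:R / sigma ^+ 2) *: Sig + 1%:M) *m Phi^T.

(* The random variables X_0..X_{N-1} and the random selection S are mutually
   independent (product rule for every choice of measurable events; for
   finitely many variables this gives the rule for every subfamily by taking
   some events to be the whole space). *)
Definition mutually_independent (R : realType) (dO : measure_display)
  (Omega : measurableType dO) (P : probability Omega R)
  (dT : measure_display) (T : measurableType dT) (N : nat) (U : finType)
  (X : 'I_N -> Omega -> T) (S : Omega -> U) : Prop :=
  forall (A : 'I_N -> set T) (B : set U), (forall i, measurable (A i)) ->
    P ((\bigcap_(i in [set: 'I_N]) (X i @^-1` A i)) `&` (S @^-1` B)) =
    ((\prod_(i < N) P (X i @^-1` A i)) * P (S @^-1` B))%E.

Definition uniform_without_replacement (R : realType) (dO : measure_display)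
  (Omega : measurableType dO) (P : probability Omega R) (N k : nat)
  (S : Omega -> {ffun 'I_k -> 'I_N}) : Prop :=
  (forall B : set {ffun 'I_k -> 'I_N}, measurable (S @^-1` B)) /\
  (forall f : {ffun 'I_k -> 'I_N},
     P (S @^-1` [set f]) =
     (if injectiveb f
      then (#|[set g : {ffun 'I_k -> 'I_N} | injectiveb g]|%:R)^-1
      else 0)%:E).

(* Main.v *)
Require Import Defs.
From HB Require Import structures.
From mathcomp Require Import all_boot all_order all_algebra.
From mathcomp Require Import all_classical all_reals all_analysis.
From mathcomp Require Import ring lra measurable_realfun.
Set Implicit Arguments. Unset Strict Implicit. Unset Printing Implicit Defensive.
Import Order.TTheory GRing.Theory Num.Theory.
Import numFieldNormedType.Exports.
Local Open Scope classical_set_scope.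
Local Open Scope ring_scope.

(** The spectral norm is dominated by the Frobenius norm, and in the constants of
    the theorem there is enough room to replace the matrix Bernstein inequality
    by a dimension-free Hoeffding inequality in the Hilbert space of matrices.
    For a centered random vector [Y] with [|Y| <= B], convexity of
    [cosh (sqrt _)] gives [E cosh (th |x + Y|) <= cosh (th |x|) cosh (th B)]: by
    [|x + Y|^2 <= |x|^2 + B^2 + 2 <x, Y>] the left-hand side is bounded by a chord,
    which is affine in the centered variable [<x, Y>]. Iterating over independent
    summands and using [cosh b <= exp (b^2 / 2)] and Markov's inequality,
    [P (|Y_1 + ... + Y_n| >= n t) <= 2 exp (- n t^2 / (2 B^2))]. It is applied with
    [Y = phi phi^T - Sigma], [B = 2 K^2] and
    [t = 2 K^2 sqrt (8 / (3 k) ln (4 r / delta)) <= lambda_min Sigma / 2], to the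
    full sample and, conditionally on the selection, to the subsample.
    On the good event both regularized covariances [A] satisfy
    [A >= 1 + N lambda_min / (2 sigma^2)], and the resolvent identity
    [A^-1 - B^-1 = A^-1 (B - A) B^-1] finishes the proof. *)

(** * The hyperbolic cosine *)

Definition coshR (R : realType) (x : R) : R := (expR x + expR (- x)) / 2.

Section HyperbolicCosine.
Variable R : realType.
Implicit Types a b p q s u v w x : R.

(** Induction on [n]: multiplying the induction hypothesis by [p * a + q * b] leaves the gap
    [p * q * (a - b) * (a ^+ n - b ^+ n)], whose last two factors have the same sign. *)
Lemma exprn_convex p q a b n : 0 <= p -> 0 <= q -> p + q = 1 ->
  0 <= a -> 0 <= b -> (p * a + q * b) ^+ n <= p * a ^+ n + q * b ^+ n.
Proof.
move=> p0 q0 pq a0 b0; elim: n => [|n IH]; first by rewrite !expr0 !mulr1 pq.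
rewrite !exprS; apply: (@le_trans _ _
  ((p * a + q * b) * (p * a ^+ n + q * b ^+ n))).
  by apply: ler_wpM2l => //; rewrite addr_ge0 ?mulr_ge0.
have q1 : q = 1 - p by rewrite -pq; ring.
have : 0 <= (a - b) * (a ^+ n - b ^+ n).
  case: (leP a b) => ab.
    by rewrite mulr_le0// subr_le0// lerXn2r.
  by rewrite mulr_ge0// subr_ge0 ?lerXn2r// ltW.
move=> /(mulr_ge0 (mulr_ge0 p0 q0)).
set A := a ^+ n; set B := b ^+ n; rewrite q1 => h.
rewrite -subr_ge0; apply: le_trans h _.
by rewrite le_eqVlt; apply/orP; left; apply/eqP; ring.
Qed.

(** The two exponential series are cut at an even number of terms, so that the odd powers cancel.
    The result is a power series in [x ^+ 2] with nonnegative coefficients, from which convexity and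
    growth are read off term by term. *)
Lemma coshR_cvg x :
  \sum_(j < n) (x ^+ 2) ^+ j / (j.*2)`!%:R @[n --> \oo] --> coshR x.
Proof.
have dbl : (n.*2)%N @[n --> \oo] --> \oo.
  move=> A [m _ mA]; exists m => // n /= mn; apply: mA => /=.
  by rewrite (leq_trans mn)// -addnn leq_addr.
have cvg_exp (y : R) : series (exp_coeff y) n @[n --> \oo] --> expR y.
  exact: is_cvg_series_exp_coeff.
have cvg2 (y : R) : series (exp_coeff y) n.*2 @[n --> \oo] --> expR y.
  by apply: (cvg_comp _ _ dbl); exact: cvg_exp.
have ch := cvgM (cvgD (cvg2 x) (cvg2 (- x))) (cvg_cst (2^-1 : R)).
suff -> : (fun n => \sum_(j < n) (x ^+ 2) ^+ j / (j.*2)`!%:R) = (fun n =>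
  (series (exp_coeff x) n.*2 + series (exp_coeff (- x)) n.*2) * 2^-1).
  exact: ch.
apply/funext => n; apply/esym.
rewrite /series /= !big_mkord; elim: n => [|n IH].
  by rewrite !big_ord0 addr0 mul0r.
rewrite doubleS !big_ord_recr /= -{}IH /exp_coeff /=.
have sgn : (-1) ^+ n.*2 = 1 :> R by rewrite -signr_odd odd_double.
rewrite -exprM mul2n [(- x) ^+ n.*2.+1]exprS [(- x) ^+ n.*2]exprNn sgn mul1r exprS.
by rewrite (mulNr x) mulNr; set F := x * _ / _; field.
Qed.

Lemma coshR_sqr_convex p q u v w : 0 <= p -> 0 <= q -> p + q = 1 ->
  u ^+ 2 <= p * v ^+ 2 + q * w ^+ 2 -> coshR u <= p * coshR v + q * coshR w.
Proof.
move=> p0 q0 pq uvw.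
have cp : p * (\sum_(j < n) (v ^+ 2) ^+ j / (j.*2)`!%:R) +
  q * (\sum_(j < n) (w ^+ 2) ^+ j / (j.*2)`!%:R) @[n --> \oo] -->
  p * coshR v + q * coshR w.
  by apply: cvgD; apply: cvgM; (exact: cvg_cst || exact: coshR_cvg).
rewrite -(cvg_lim (@Rhausdorff R) (@coshR_cvg u)) -(cvg_lim (@Rhausdorff R) cp).
apply: ler_lim; [by apply: cvgP; exact: coshR_cvg|by apply: cvgP; exact: cp|].
apply: nearW => n /=; rewrite !mulr_sumr -big_split /=; apply: ler_sum => j _.
rewrite !mulrA -mulrDl ler_wpM2r ?invr_ge0//.
apply: le_trans (exprn_convex _ p0 q0 pq _ _); rewrite ?sqr_ge0//.
apply: lerXn2r => //; rewrite nnegrE; first exact: sqr_ge0.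
by apply: addr_ge0; apply: mulr_ge0 => //; exact: sqr_ge0.
Qed.

Lemma ler_coshR u v : u ^+ 2 <= v ^+ 2 -> coshR u <= coshR v.
Proof.
move=> uv; have := @coshR_sqr_convex 1 0 u v 0 ler01 (lexx 0) (addr0 1).
by rewrite !mul1r !mul0r !addr0; apply.
Qed.

Lemma expR_le_coshR x : expR x / 2 <= coshR x.
Proof. by rewrite ler_pM2r ?invr_gt0// lerDl expR_ge0. Qed.

Lemma coshR_ge0 x : 0 <= coshR x.
Proof. by rewrite divr_ge0 ?addr_ge0 ?expR_ge0. Qed.

Lemma coshR0 : coshR 0 = 1 :> R.
Proof. by rewrite /coshR oppr0 expR0; field. Qed.

Lemma measurable_coshR : measurable_fun setT (@coshR R).
Proof.
apply: measurable_funM => //; apply: measurable_funD => //.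
exact: (measurableT_comp (@measurable_expR R)).
Qed.

(* The chord of the convex function [cosh (sqrt _)] between [(a - b)^2] and
   [(a + b)^2]. *)
Lemma coshR_chord a b : 0 <= a -> 0 <= b -> exists c, forall s w,
  `|s| <= a * b -> w ^+ 2 <= a ^+ 2 + b ^+ 2 + 2 * s ->
  coshR w <= coshR a * coshR b + c * s.
Proof.
(* The slope of the chord in [s] is [sinh a * sinh b / (a * b)], since [cosh (a + b)] and
   [cosh (a - b)] differ from [cosh a * cosh b] by plus or minus [sinh a * sinh b]. If [a * b = 0],
   the inverse is 0 by convention, and [s = 0] anyway. *)
move=> a0 b0; exists ((expR a - expR (- a)) * (expR b - expR (- b)) / 4 / (a * b)).
move=> s w sab hw; have [ab0|ab0] := eqVneq (a * b) 0.
  rewrite ab0 invr0 mulr0 mul0r addr0.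
  move: sab; rewrite ab0 normr_le0 => /eqP s0; move: hw; rewrite s0 mulr0 addr0.
  have [a00|b00] : a = 0 \/ b = 0 by move/eqP: ab0;
    rewrite mulf_eq0 => /orP[]/eqP; tauto.
    by rewrite a00 expr0n add0r => /ler_coshR; rewrite coshR0 mul1r.
  by rewrite b00 expr0n addr0 => /ler_coshR; rewrite coshR0 mulr1.
have abp : 0 < a * b by rewrite lt_def ab0 mulr_ge0.
(* With [t] in [-1, 1], the number [a ^+ 2 + b ^+ 2 + 2 * s] is the mean of [(a + b) ^+ 2] and
   [(a - b) ^+ 2] with weights [(1 + t) / 2] and [(1 - t) / 2]. *)
pose t := s / (a * b).
have st : s = t * (a * b) by rewrite /t divfK.
have /andP[t1 t2] : -1 <= t <= 1.
  by rewrite -ler_norml /t normrM normfV (gtr0_norm abp) ler_pdivrMr// mul1r.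
apply: le_trans (@coshR_sqr_convex ((1 + t) / 2) ((1 - t) / 2) w (a + b) (a - b)
  _ _ _ _) _.
- by apply: divr_ge0 => //; lra.
- by apply: divr_ge0 => //; lra.
- by field.
- apply: le_trans hw _; rewrite le_eqVlt; apply/orP; left; apply/eqP.
  by rewrite st; field.
rewrite le_eqVlt; apply/orP; left; apply/eqP; rewrite st /coshR.
rewrite !(opprD, opprK) !expRD; field.
by move: ab0; rewrite mulf_eq0 negb_or andbC.
Qed.

(** Term by term this is [2 ^ j * j! <= (2 j)!]. *)
Lemma coshR_le_expR x : coshR x <= expR (x ^+ 2 / 2).
Proof.
have ce : series (exp_coeff (x ^+ 2 / 2)) n @[n --> \oo] --> expR (x ^+ 2 / 2).
  exact: is_cvg_series_exp_coeff.
rewrite -(cvg_lim (@Rhausdorff R) (@coshR_cvg x)) -(cvg_lim (@Rhausdorff R) ce).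
apply: ler_lim; [by apply: cvgP; exact: coshR_cvg|by apply: cvgP; exact: ce|].
apply: nearW => n /=; rewrite /series /= big_mkord; apply: ler_sum => j _.
rewrite /exp_coeff /= expr_div_n -mulrA -invfM ler_wpM2l//.
  by apply: exprn_ge0; exact: sqr_ge0.
rewrite lef_pV2 ?posrE ?mulr_gt0 ?exprn_gt0 ?ltr0n ?fact_gt0//.
rewrite -natrX -natrM ler_nat; elim: (j : nat) => // m IH.
rewrite doubleS !factS expnS.
have -> : (2 * 2 ^ m * (m.+1 * m`!) = (m.+1).*2 * (2 ^ m * m`!))%N.
  by rewrite -mul2n; ring.
rewrite doubleS leq_mul//; apply: leq_trans IH _; exact: leq_pmull.
Qed.

End HyperbolicCosine.

(** * Independence and Hoeffding's inequality in Euclidean space *)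

(** Vectors are functions on any finite type, so that matrices, indexed by pairs, are included and
    get the Frobenius norm. *)
Definition dot (R : realType) (I : finType) (x y : I -> R) : R :=
  \sum_i x i * y i.
Definition enorm (R : realType) (I : finType) (x : I -> R) : R :=
  Num.sqrt (dot x x).

Section Euclidean.
Variables (R : realType) (I : finType).
Implicit Types x y : I -> R.

Lemma dot_ge0 x : 0 <= dot x x.
Proof. by apply: sumr_ge0 => i _; rewrite -expr2 sqr_ge0. Qed.

Lemma enorm_ge0 x : 0 <= enorm x. Proof. exact: sqrtr_ge0. Qed.

Lemma sqr_enorm x : enorm x ^+ 2 = dot x x.
Proof. by rewrite sqr_sqrtr ?dot_ge0. Qed.

(** After multiplication by [dot y y], the gap between the squares is the sum of squares of the
    coordinates of [dot y y * x - dot x y * y]. *)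
Lemma cauchy_schwarz x y : `|dot x y| <= enorm x * enorm y.
Proof.
rewrite -(@ler_pXn2r _ 2)// ?nnegrE ?mulr_ge0 ?enorm_ge0//.
rewrite real_normK ?num_real// exprMn !sqr_enorm.
have [y0|y0] := eqVneq (dot y y) 0.
  have yi i : y i = 0.
    have /eqP := y0; rewrite /dot psumr_eq0 => [/allP/(_ i)|j _].
      by rewrite mem_index_enum -expr2 sqrf_eq0 => /(_ isT)/eqP.
    by rewrite -expr2 sqr_ge0.
  by rewrite y0 mulr0 /dot big1 ?expr0n// => i _; rewrite yi mulr0.
have yp : 0 < dot y y by rewrite lt_def y0 dot_ge0.
rewrite -subr_ge0 -(pmulr_rge0 _ yp).
have -> : dot y y * (dot x x * dot y y - dot x y ^+ 2) =
    \sum_i (dot y y * x i - dot x y * y i) ^+ 2.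
  rewrite (eq_bigr (fun i => dot y y ^+ 2 * (x i * x i) +
    - (2 * dot y y * dot x y) * (x i * y i) + dot x y ^+ 2 * (y i * y i))).
    by rewrite !big_split /= -!mulr_sumr; rewrite /dot; ring.
  by move=> i _; ring.
by apply: sumr_ge0 => i _; rewrite sqr_ge0.
Qed.

Lemma dot_add_scale x y c : dot (fun i => x i + c * y i) (fun i => x i + c * y i) =
  dot x x + 2 * c * dot x y + c ^+ 2 * dot y y.
Proof. by rewrite /dot !mulr_sumr -!big_split /=; apply: eq_bigr => i _; ring. Qed.

End Euclidean.

(** By uniqueness of product measures the joint law of [(Z, Y)] is the law of [Z] times [Q]; Tonelli
    does the rest. The measure [mu] is only finite, which admits the restriction of a probability to
    an event. *)
Lemma integral_independent d d1 d2 (Omega : measurableType d)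
  (T1 : measurableType d1) (T2 : measurableType d2) (R : realType)
  (mu : {finite_measure set Omega -> \bar R}) (Q : probability T2 R)
  (Z : Omega -> T1) (Y : Omega -> T2) (F : T1 * T2 -> \bar R) :
  measurable_fun setT Z -> measurable_fun setT Y ->
  (forall A B, measurable A -> measurable B ->
    mu (Z @^-1` A `&` Y @^-1` B) = mu (Z @^-1` A) * Q B)%E ->
  measurable_fun setT F -> (forall z, 0 <= F z)%E ->
  (\int[mu]_w F (Z w, Y w) = \int[mu]_w (\int[Q]_y F (Z w, y)))%E.
Proof.
move=> mZ mY indep mF F0.
have mZY : measurable_fun setT (fun w => (Z w, Y w)) by exact: measurable_fun_pair.
have finZ : forall U, measurable U -> pushforward mu Z U \is a fin_num.
  by move=> U mU; apply: fin_num_measure; rewrite -[X in measurable X]setTI; exact: mZ.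
pose m0 : {measure set T1 -> \bar R} :=
  measure_function_pushforward__canonical__measure_function_Measure mu mZ.
pose m1 : {finite_measure set T1 -> \bar R} :=
  HB.pack (Measure.sort m0) (Measure_isFinite.Build _ _ _ m0 finZ).
pose m2 : {measure set (T1 * T2) -> \bar R} :=
  measure_function_pushforward__canonical__measure_function_Measure mu mZY.
have prodE : forall U, measurable U -> (m1 \x Q)%E U = m2 U.
  by apply: product_measure_unique => A B mA mB; rewrite -indep.
rewrite -(@ge0_integral_pushforward _ _ _ _ _ _ mZY mu setT F)//.
rewrite (eq_measure_integral (m1 \x Q)%E); last first.
  by move=> A mA _; apply/esym; exact: prodE.
rewrite fubini_tonelli1//.
rewrite (@ge0_integral_pushforward _ _ _ _ _ _ mZ mu setT)//.
  by apply: measurable_fun_fubini_tonelli_F.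
by move=> z _; apply: integral_ge0.
Qed.

Lemma measurable_enorm d (T : measurableType d) (R : realType) (I : finType)
  (f : T -> I -> R) : (forall i, measurable_fun setT (f ^~ i)) ->
  measurable_fun setT (fun x => enorm (f x)).
Proof.
move=> mf; apply: (@measurableT_comp _ _ _ _ _ _ (@Num.sqrt R)).
  by apply: continuous_measurable_fun; exact: sqrt_continuous.
by apply: measurable_sum => i; apply: measurable_funM.
Qed.

Section OneStep.
Context d (T : measurableType d) (R : realType) (Q : probability T R).
Variables (I : finType) (psi : T -> I -> R) (B : R).
Hypothesis mpsi : forall i, measurable_fun setT (psi ^~ i).
Hypothesis psi_le : forall y, enorm (psi y) <= B.
Hypothesis psi_mean : forall i, (\int[Q]_y (psi y i)%:E = 0)%E.

Lemma integrable_coord i : Q.-integrable setT (fun y => (psi y i)%:E).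
Proof.
apply: (@measurable_bounded_integrable _ _ _ Q (psi ^~ i) setT measurableT) => //.
  by rewrite (le_lt_trans (probability_le1 Q measurableT))// ltry.
exists B; split; first exact: num_real.
move=> M BM y _ /=; apply: le_trans (ltW BM); apply: le_trans (psi_le y).
rewrite -[leLHS]ger0_norm// -sqrtr_sqr /enorm ler_sqrt ?dot_ge0//.
rewrite real_normK ?num_real// /dot (bigD1 i)//= expr2 lerDl.
by apply: sumr_ge0 => j _; rewrite -expr2 sqr_ge0.
Qed.

Lemma integral_coshR_step (x : I -> R) (th c : R) : 0 <= th -> 0 <= c ->
  (\int[Q]_y (coshR (th * enorm (fun i => x i + c * psi y i)))%:E <=
   (coshR (th * enorm x) * coshR (th * (c * B)))%:E)%E.
Proof.
move=> th0 c0.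
(* Measurable types are pointed, so some norm lies below [B]. *)
have B0 : 0 <= B by exact: le_trans (enorm_ge0 _) (psi_le point).
have ta0 : 0 <= th * enorm x by rewrite mulr_ge0 ?enorm_ge0.
have tb0 : 0 <= th * (c * B) by rewrite !mulr_ge0.
have [kap kapP] := coshR_chord ta0 tb0.
set K0 := coshR _ * coshR _.
pose be i := kap * (th ^+ 2 * c * x i).
(* The chord bound is used at [s = th ^+ 2 * c * dot x (psi y)]; Cauchy-Schwarz provides its
   condition on [s]. The correction is linear in [psi y] and integrates to 0. *)
have bnd y : coshR (th * enorm (fun i => x i + c * psi y i)) <=
    K0 + \sum_i be i * psi y i.
  have -> : \sum_i be i * psi y i = kap * (th ^+ 2 * c * dot x (psi y)).
    by rewrite /dot !mulr_sumr; apply: eq_bigr => i _; rewrite /be; ring.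
  apply: kapP.
    rewrite normrM ger0_norm ?mulr_ge0 ?sqr_ge0//.
    apply: (@le_trans _ _ (th ^+ 2 * c * (enorm x * B))).
      apply: ler_wpM2l; first by rewrite mulr_ge0 ?sqr_ge0.
      apply: le_trans (cauchy_schwarz _ _) _.
      by apply: ler_wpM2l; rewrite ?enorm_ge0.
    by rewrite le_eqVlt; apply/orP; left; apply/eqP; ring.
  rewrite !exprMn !sqr_enorm dot_add_scale -sqr_enorm.
  have h : dot (psi y) (psi y) <= B ^+ 2.
    by rewrite -sqr_enorm lerXn2r ?nnegrE ?enorm_ge0.
  have := ler_wpM2l (mulr_ge0 (sqr_ge0 th) (sqr_ge0 c)) h; lra.
have mbe : measurable_fun setT (fun y => \sum_i be i * psi y i).
  by apply: measurable_sum => i; apply: measurable_funM.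
apply: (@le_trans _ _ (\int[Q]_y (K0 + \sum_i be i * psi y i)%:E)%E).
  apply: ge0_le_integral => //.
  - by move=> y _; rewrite lee_fin coshR_ge0.
  - apply/measurable_EFinP; apply: (measurableT_comp (@measurable_coshR R)).
    apply: measurable_funM => //; apply: measurable_enorm => i.
    by apply: measurable_funD => //; exact: measurable_funM.
  - by apply/measurable_EFinP; exact: measurable_funD.
  - by move=> y _; rewrite lee_fin.
under eq_integral do rewrite EFinD.
have ibe i : Q.-integrable setT (fun y => (be i)%:E * (psi y i)%:E)%E.
  by apply: integrableZl => //; exact: integrable_coord.
rewrite integralD//; first last.
- rewrite (_ : (fun _ => _) = (fun y => \sum_i ((be i)%:E * (psi y i)%:E)%E)%E).
    by apply: integrable_sum.
  by apply/funext => y; rewrite -sumEFin; apply: eq_bigr => i _; rewrite EFinM.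
- by apply: finite_measure_integrable_cst.
under [X in (_ + X)%E]eq_integral do rewrite -sumEFin.
under [X in (_ + X)%E]eq_integral do under eq_bigr do rewrite EFinM.
rewrite integral_sum// big1 ?adde0; last first.
  by move=> i _; rewrite integralZl ?psi_mean ?mule0//; exact: integrable_coord.
by rewrite integral_cst// [X in (_ * X)%E]probability_setT mule1.
Qed.

End OneStep.

Section Hoeffding.
Context dO (Omega : measurableType dO) dT (T : measurableType dT) (R : realType).
Variables (mu : {finite_measure set Omega -> \bar R}) (Q : probability T R).
Variables (N : nat) (X : 'I_N -> Omega -> T).
Hypothesis mX : forall i, measurable_fun setT (X i).
(** Independence with common law [Q], up to the total mass of [mu]. The restriction of [P] to an
    event about the selection has this form, which replaces conditional probabilities. *)
Hypothesis indep : forall A, (forall i, measurable (A i)) ->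
  (mu (\bigcap_(i in [set: 'I_N]) X i @^-1` A i) =
   (\prod_(i < N) Q (A i)) * mu setT)%E.

(* The events generating the sigma-algebra of [X_0, ..., X_(n-1)]. *)
Definition past (n : nat) : set (set Omega) :=
  [set C | exists2 A : 'I_N -> set T,
     forall i, measurable (A i) /\ ((n <= i)%N -> A i = setT) &
     C = \bigcap_(i in [set: 'I_N]) X i @^-1` A i].

Lemma past_measurable n : past n `<=` measurable.
Proof.
move=> _ [A mA ->]; apply: fin_bigcap_measurable => // i _.
by rewrite -[X in measurable X]setTI; apply: mX => //; case: (mA i).
Qed.

Lemma sigma_past_measurable n : <<s past n >> `<=` measurable.
Proof.
apply: smallest_sub; [exact: sigma_algebra_measurable|exact: past_measurable].
Qed.

Lemma past_setI n : setI_closed (past n).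
Proof.
move=> _ _ [A mA ->] [A' mA' ->]; exists (fun i => A i `&` A' i).
  move=> i; have [? Ai] := mA i; have [? A'i] := mA' i.
  by split; [exact: measurableI|move=> ni; rewrite Ai// A'i// setIT].
by rewrite -bigcapI.
Qed.

Lemma past_setT n : past n setT.
Proof.
by exists (fun=> setT) => //; apply/seteqP; split.
Qed.

(** Both sides are finite measures in [C]. They agree on the pi-system [past n], hence on the
    sigma-algebra that it generates. *)
Lemma past_indep (n : 'I_N) C U : <<s past n >> C -> measurable U ->
  (mu (C `&` X n @^-1` U) = mu C * Q U)%E.
Proof.
move=> sC mU.
have mXU : measurable (X n @^-1` U) by rewrite -[X in measurable X]setTI; exact: mX.
have QUfin : Q U \is a fin_num by exact: fin_num_measure.
have q0 : 0 <= fine (Q U) by exact: fine_ge0.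
rewrite muleC -(fineK QUfin).
apply: (g_sigma_algebra_measure_unique (past n) (@past_measurable n) (fun=> setT)
  (fun=> past_setT n) _ (mrestr mu mXU) (mscale (NngNum q0) mu) _ _ _ _ sC) => //.
- by rewrite bigcup_const//; exists 0%N.
- exact: past_setI.
- move=> _ [A mA ->]; rewrite /mrestr /mscale /=; change
    (mu (\bigcap_(i in [set: 'I_N]) X i @^-1` A i `&` X n @^-1` U) =
     (fine (Q U))%:E * mu (\bigcap_(i in [set: 'I_N]) X i @^-1` A i))%E.
  rewrite fineK//.
  have An : A n = setT by have [_] := mA n; apply.
  (* Events of [past n] leave coordinate [n] free, so [U] can be inserted there. *)
  pose A' i := if i == n then U else A i.
  have -> : \bigcap_(i in [set: 'I_N]) X i @^-1` A i `&` X n @^-1` U =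
      \bigcap_(i in [set: 'I_N]) X i @^-1` A' i.
    apply/seteqP; split => [w [wA wU] i _|w wA'] /=.
      by rewrite /A'; case: eqP => [->//|_]; exact: wA.
    split; last by have := wA' n I; rewrite /A' /= eqxx.
    by move=> i _ /=; have := wA' i I; rewrite /A' /=; case: eqP => [->|//]; rewrite An.
  rewrite !indep; first last.
  - by move=> i; rewrite /A'; case: ifP => // _; case: (mA i).
  - by move=> i; case: (mA i).
  rewrite (bigD1 n)//= [in RHS](bigD1 n)//= /A' eqxx An probability_setT mul1e.
  rewrite muleA; congr (_ * _ * _)%E; apply: eq_bigr => i /negbTE ->//.
- move=> _; rewrite /mrestr ltey_eq; apply/orP; left.
  by apply: fin_num_measure.
Qed.

Variables (I : finType) (psi : T -> I -> R) (B : R) (c : 'I_N -> R).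
Hypothesis mpsi : forall i, measurable_fun setT (psi ^~ i).
Hypothesis psi_le : forall y, enorm (psi y) <= B.
Hypothesis psi_mean : forall i, (\int[Q]_y (psi y i)%:E = 0)%E.
Hypothesis c_ge0 : forall j, 0 <= c j.

(** The weights [c] treat the full sample (all weights 1) and a subsample (0/1 weights) alike. *)
Definition partial_sum (n : nat) (w : Omega) (i : I) : R :=
  \sum_(j < N | (j < n)%N) c j * psi (X j w) i.

Lemma partial_sumS (n : 'I_N) w i :
  partial_sum n.+1 w i = partial_sum n w i + c n * psi (X n w) i.
Proof.
rewrite /partial_sum (bigD1 n)//= addrC; congr (_ + _); apply: eq_bigl => j.
by rewrite ltnS ltn_neqAle andbC.
Qed.

(** The sum is adapted: [X n] is independent of the sigma-algebra of the past, so measurability for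
    the ambient one would not suffice. *)
Lemma measurable_partial_sum_past n i :
  measurable_fun setT (fun w : g_sigma_algebraType (past n) => partial_sum n w i).
Proof.
rewrite /partial_sum; under eq_fun do rewrite big_mkcond.
apply: measurable_sum => j; have [jn|//] := boolP (j < n)%N.
apply: measurable_funM => //.
apply: (measurableT_comp (mpsi i)) => _ U mU; rewrite setTI.
apply: sub_sigma_algebra; exists (fun i => if i == j then U else setT).
  move=> l; case: eqP => [->|_]; split => //.
  by rewrite leqNgt jn.
apply/seteqP; split => [w wU l _ /=|w /(_ j Logic.I) /=]; first by case: eqP => // ->.
by rewrite eqxx.
Qed.

Lemma measurable_id_past n :
  measurable_fun setT (id : Omega -> g_sigma_algebraType (past n)).
Proof. by move=> _ U sU; rewrite setTI; exact: (sigma_past_measurable sU). Qed.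

Lemma measurable_partial_sum n i :
  measurable_fun setT (fun w => partial_sum n w i).
Proof.
move=> _ U mU; apply: (sigma_past_measurable (n := n)).
exact: (@measurable_partial_sum_past n i measurableT U mU).
Qed.

Lemma measurable_coshR_partial_sum th n :
  measurable_fun setT (fun w => coshR (th * enorm (partial_sum n w))).
Proof.
apply: (measurableT_comp (@measurable_coshR R)); apply: measurable_funM => //.
by apply: measurable_enorm => i; exact: measurable_partial_sum.
Qed.

Lemma integral_coshR_partial_sum (th : R) n : 0 <= th -> (n <= N)%N ->
  (\int[mu]_w (coshR (th * enorm (partial_sum n w)))%:E <=
   (expR (th ^+ 2 * B ^+ 2 / 2 * \sum_(j < N | (j < n)%N) c j ^+ 2))%:E * mu setT)%E.
Proof.
move=> th0; elim: n => [_|n IH nN].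
  under eq_integral => w _.
    rewrite (_ : partial_sum 0 w = fun=> 0); last first.
      by apply/funext => i; rewrite /partial_sum big1.
    rewrite /enorm /dot big1 ?mulr0// sqrtr0 mulr0 coshR0; over.
  by rewrite big1// mulr0 expR0 integral_cst.
pose m := Ordinal nN.
pose Om := g_sigma_algebraType (past n).
(* The past enters as the identity map from [Omega] to the same set with the coarser sigma-algebra.
   This is the variable [Z] of [integral_independent], and [X m] is integrated out first. *)
pose F (z : Om * T) : \bar R :=
  (coshR (th * enorm (fun i => partial_sum n z.1 i + c m * psi z.2 i)))%:E.
have mF : measurable_fun setT F.
  apply/measurable_EFinP; apply: (measurableT_comp (@measurable_coshR R)).
  apply: measurable_funM => //; apply: measurable_enorm => i.
  apply: measurable_funD.
    exact: (measurableT_comp (@measurable_partial_sum_past n i) measurable_fst).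
  by apply: measurable_funM => //; apply: (measurableT_comp (mpsi i)).
have mid := @measurable_id_past n.
have mcosh := @measurable_coshR_partial_sum th n.
have := @integral_independent _ _ _ Omega Om T R mu Q id (X m) F mid (mX m).
move=> /(_ _ mF) step.
under eq_integral => w _.
  rewrite (_ : (_)%:E = F (w, X m w)); last first.
    rewrite /F /=; congr (coshR (th * enorm _))%:E.
    by apply/funext => i; rewrite (partial_sumS m).
  over.
rewrite /= step; last 2 first.
- by move=> C U sC mU; exact: (past_indep (n := m)).
- by move=> z; rewrite lee_fin coshR_ge0.
apply: (@le_trans _ _ (\int[mu]_w ((coshR (th * enorm (partial_sum n w)))%:E *
    (coshR (th * (c m * B)))%:E))%E).
  apply: ge0_le_integral => //.
  - by move=> w _; apply: integral_ge0 => y _; rewrite lee_fin coshR_ge0.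
  - have F0 z : (0 <= F z)%E by rewrite lee_fin coshR_ge0.
    have mFF := @measurable_fun_fubini_tonelli_F _ _ _ _ _ Q F mF F0.
    move=> _ U mU; apply: (sigma_past_measurable (n := n)); exact: mFF.
  - by apply: emeasurable_funM => //; apply/measurable_EFinP.
  - move=> w _; rewrite -EFinM; exact: (@integral_coshR_step _ _ _ Q I
      psi B mpsi psi_le psi_mean (partial_sum n w) th (c m) th0 (c_ge0 m)).
rewrite ge0_integralZr//; first last.
- by rewrite lee_fin coshR_ge0.
- by move=> w _; rewrite lee_fin coshR_ge0.
- exact/measurable_EFinP.
apply: (@le_trans _ _ ((expR (th ^+ 2 * B ^+ 2 / 2 *
    \sum_(j < N | (j < n)%N) c j ^+ 2))%:E * mu setT *
    (expR ((th * (c m * B)) ^+ 2 / 2))%:E)%E).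
  apply: lee_pmul => //; rewrite ?lee_fin ?coshR_ge0 ?coshR_le_expR//.
    by apply: integral_ge0 => w _; rewrite lee_fin coshR_ge0.
  exact: IH (ltnW nN).
rewrite muleAC -EFinM -expRD [X in (_ <= (expR (_ * X))%:E * _)%E](bigD1 m)//=.
rewrite le_eqVlt; apply/orP; left; apply/eqP; congr ((expR _)%:E * _)%E.
rewrite [X in _ = _ * (_ + X)](eq_bigl (fun j : 'I_N => (j < n)%N)); last first.
  by move=> j; rewrite ltnS ltn_neqAle andbC.
by set S := \sum_(_ < _ | _) _; field.
Qed.

Lemma hilbert_hoeffding (t : R) : 0 < B -> 0 <= t -> 0 < \sum_j c j ^+ 2 ->
  (mu [set w | (t <= enorm (fun i => \sum_j c j * psi (X j w) i))%R] <=
   (2 * expR (- (t ^+ 2 / (2 * B ^+ 2 * \sum_j c j ^+ 2))))%:E * mu setT)%E.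
Proof.
move=> B0 t0; set V := \sum_j c j ^+ 2 => V0.
(* This [th] minimizes the exponent [th ^+ 2 * B ^+ 2 * V / 2 - th * t]. *)
pose th := t / (B ^+ 2 * V).
have th0 : 0 <= th by rewrite divr_ge0 ?mulr_ge0 ?sqr_ge0// ltW.
have sumE w : partial_sum N w = fun i => \sum_j c j * psi (X j w) i.
  by apply/funext => i; apply: eq_bigl => j; rewrite ltn_ord.
have mcosh := @measurable_coshR_partial_sum th N.
(* The threshold for Markov's inequality uses [expR x / 2 <= coshR x]; its denominator is the factor
   2 of the tail bound. *)
pose a := expR (th * t) / 2.
have a0 : 0 < a by rewrite divr_gt0 ?expR_gt0.
have markov := @le_integral_abse _ _ _ mu setT measurableT
  (fun w => (coshR (th * enorm (partial_sum N w)))%:E) a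
  ((measurable_EFinP _ _).2 mcosh) a0.
have int_le := integral_coshR_partial_sum th0 (leqnn N).
have eV : \sum_(j < N | (j < N)%N) c j ^+ 2 = V.
  by apply: eq_bigl => j; rewrite ltn_ord.
rewrite eV in int_le.
have le_a : (a%:E * mu [set w | (t <= enorm (fun i => \sum_j c j * psi (X j w) i))%R]
    <= (expR (th ^+ 2 * B ^+ 2 / 2 * V))%:E * mu setT)%E.
  apply: le_trans int_le; apply: le_trans.
    2: { apply: le_trans markov _; rewrite le_eqVlt; apply/orP; left; apply/eqP.
      by apply: eq_integral => w _; rewrite gee0_abs// lee_fin coshR_ge0. }
  apply: lee_wpmul2l; first by rewrite lee_fin ltW.
  apply: le_measure; rewrite ?inE//.
  - rewrite (_ : [set w | _] = (fun w => t <= enorm (partial_sum N w)) @^-1` [set true]).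
      rewrite -[X in measurable X]setTI; apply: measurable_fun_ler => //.
      by apply: measurable_enorm => i; exact: measurable_partial_sum.
    by apply/seteqP; split => w /=; rewrite sumE.
  - rewrite (_ : _ `&` _ =
        (fun w => a <= coshR (th * enorm (partial_sum N w))) @^-1` [set true]).
      by rewrite -[X in measurable X]setTI; apply: measurable_fun_ler.
    rewrite setTI; apply/seteqP; split => w /=;
      by rewrite lee_fin ger0_norm ?coshR_ge0.
  move=> w /=; rewrite -sumE => tw; split => //.
  rewrite lee_fin ger0_norm ?coshR_ge0//.
  apply: le_trans (expR_le_coshR _); rewrite ler_pM2r ?invr_gt0// ler_expR.
  exact: ler_wpM2l.
move: le_a; rewrite -lee_pdivlMl// muleA -EFinM => le_a.
apply: le_trans le_a _; rewrite le_eqVlt; apply/orP; left; apply/eqP.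
congr (_%:E * _)%E; rewrite /a invf_div -[2 / _ * _]mulrA -expRN -expRD.
by congr (_ * expR _); rewrite /th; field; rewrite !gt_eqF.
Qed.

End Hoeffding.

(** * Coercive matrices and the smallest eigenvalue *)

Definition vdot (R : realType) (n : nat) (u v : 'cV[R]_n) : R := (u^T *m v) 0 0.
Definition frob_norm (R : realType) (m n : nat) (A : 'M[R]_(m, n)) : R :=
  enorm (fun p : 'I_m * 'I_n => A p.1 p.2).

Section LinearAlgebra.
Variable R : realType.

Lemma vdotE n (u v : 'cV[R]_n) : vdot u v = dot (u^~ 0) (v^~ 0).
Proof. by rewrite /vdot mxE; apply: eq_bigr => i _; rewrite mxE. Qed.

Lemma vnorm2E n (v : 'cV[R]_n) : vnorm2 v = enorm (v^~ 0).
Proof. by []. Qed.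

Lemma vnorm2_ge0 n (v : 'cV[R]_n) : 0 <= vnorm2 v.
Proof. exact: enorm_ge0. Qed.

Lemma sqr_vnorm2 n (v : 'cV[R]_n) : vnorm2 v ^+ 2 = vdot v v.
Proof. by rewrite vnorm2E sqr_enorm vdotE. Qed.

Lemma vdotC n (u v : 'cV[R]_n) : vdot u v = vdot v u.
Proof. by rewrite !vdotE /dot; apply: eq_bigr => i _; rewrite mulrC. Qed.

Lemma vdotDl n (u v w : 'cV[R]_n) : vdot (u + v) w = vdot u w + vdot v w.
Proof. by rewrite /vdot linearD /= mulmxDl mxE. Qed.

Lemma vdotDr n (u v w : 'cV[R]_n) : vdot w (u + v) = vdot w u + vdot w v.
Proof. by rewrite vdotC vdotDl !(vdotC w). Qed.

Lemma vdotZl n a (u v : 'cV[R]_n) : vdot (a *: u) v = a * vdot u v.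
Proof. by rewrite /vdot linearZ /= -scalemxAl mxE. Qed.

Lemma vdotZr n a (u v : 'cV[R]_n) : vdot u (a *: v) = a * vdot u v.
Proof. by rewrite vdotC vdotZl vdotC. Qed.

Lemma vdot_mulmx m n (A : 'M[R]_(m, n)) u v : vdot u (A *m v) = vdot (A^T *m u) v.
Proof. by rewrite /vdot trmx_mul trmxK mulmxA. Qed.

Lemma vnorm2_eq0 n (v : 'cV[R]_n) : vnorm2 v = 0 -> v = 0.
Proof.
move=> v0; have /eqP : vdot v v = 0 by rewrite -sqr_vnorm2 v0 expr0n.
rewrite vdotE /dot psumr_eq0 => [/allP vi|i _]; last by rewrite -expr2 sqr_ge0.
apply/matrixP => i j; rewrite ord1 mxE; apply/eqP; rewrite -sqrf_eq0 expr2.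
by have := vi i; rewrite mem_index_enum => /(_ isT).
Qed.

Lemma vnorm20 n : vnorm2 (0 : 'cV[R]_n) = 0.
Proof. by rewrite /vnorm2 big1 ?sqrtr0// => i _; rewrite mxE expr0n. Qed.

Lemma vnorm2Z n a (v : 'cV[R]_n) : vnorm2 (a *: v) = `|a| * vnorm2 v.
Proof.
apply/eqP; rewrite -(@eqrXn2 _ 2)// ?mulr_ge0 ?vnorm2_ge0//.
by rewrite exprMn real_normK ?num_real// !sqr_vnorm2 vdotZl vdotZr mulrA expr2.
Qed.

Lemma vdot_le n (u v : 'cV[R]_n) : `|vdot u v| <= vnorm2 u * vnorm2 v.
Proof. by rewrite vdotE; exact: cauchy_schwarz. Qed.

Lemma frob_norm_ge0 m n (A : 'M[R]_(m, n)) : 0 <= frob_norm A.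
Proof. exact: enorm_ge0. Qed.

Lemma sqr_frob_norm m n (A : 'M[R]_(m, n)) :
  frob_norm A ^+ 2 = \sum_i \sum_j A i j ^+ 2.
Proof.
rewrite sqr_enorm /dot pair_bigA /=.
by apply: eq_bigr => p _; rewrite expr2.
Qed.

Lemma frob_norm_tr m n (A : 'M[R]_(m, n)) : frob_norm A^T = frob_norm A.
Proof.
apply/eqP; rewrite -(@eqrXn2 _ 2)// ?frob_norm_ge0// !sqr_frob_norm exchange_big.
by apply/eqP; apply: eq_bigr => i _; apply: eq_bigr => j _; rewrite mxE.
Qed.

Lemma vnorm2_mulmx m n (A : 'M[R]_(m, n)) v :
  vnorm2 (A *m v) <= frob_norm A * vnorm2 v.
Proof.
rewrite -(@ler_pXn2r _ 2)// ?nnegrE ?mulr_ge0 ?frob_norm_ge0 ?vnorm2_ge0//.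
rewrite exprMn sqr_frob_norm mulr_suml sqr_vnorm2 vdotE /dot.
apply: ler_sum => i _; rewrite -expr2 mxE -[\sum_j _]/(dot (A i) (v^~ 0)).
rewrite -real_normK ?num_real//.
have -> : \sum_j A i j ^+ 2 = enorm (A i) ^+ 2.
  by rewrite sqr_enorm; apply: eq_bigr => j _; rewrite expr2.
rewrite -exprMn lerXn2r ?nnegrE ?mulr_ge0 ?enorm_ge0 ?vnorm2_ge0//.
exact: cauchy_schwarz.
Qed.

Lemma frob_normD m n (A B : 'M[R]_(m, n)) :
  frob_norm (A + B) <= frob_norm A + frob_norm B.
Proof.
rewrite -(@ler_pXn2r _ 2)// ?nnegrE ?addr_ge0 ?frob_norm_ge0//.
rewrite sqrrD !sqr_enorm.
have := @dot_add_scale R _ (fun p => A p.1 p.2) (fun p => B p.1 p.2) 1.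
have -> : (fun i : 'I_m * 'I_n => A i.1 i.2 + 1 * B i.1 i.2) =
    (fun i => (A + B) i.1 i.2) by apply/funext => i; rewrite mxE mul1r.
move=> ->; have := ler_norm (dot (fun p => A p.1 p.2) (fun p => B p.1 p.2)).
have := cauchy_schwarz (fun p => A p.1 p.2) (fun p => B p.1 p.2).
by rewrite /frob_norm; lra.
Qed.

Lemma frob_normN m n (A : 'M[R]_(m, n)) : frob_norm (- A) = frob_norm A.
Proof.
apply/eqP; rewrite -(@eqrXn2 _ 2)// ?frob_norm_ge0// !sqr_frob_norm.
by apply/eqP; apply: eq_bigr => i _; apply: eq_bigr => j _; rewrite mxE sqrrN.
Qed.

Lemma spec_norm_le m n (A : 'M[R]_(m, n)) c : 0 <= c ->
  (forall v, vnorm2 (A *m v) <= c * vnorm2 v) -> spec_norm A <= c.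
Proof.
move=> c0 Ac; rewrite /spec_norm.
(* In dimension 0 there is no unit vector and the [sup] is 0 by convention; hence the assumption
   [0 <= c]. *)
set E := [set _ | _ in _]; have [->|/set0P E0] := eqVneq E set0; first by rewrite sup0.
apply: ge_sup => // _ [v v1 <-].
by apply: le_trans (Ac v) _; rewrite v1 mulr1.
Qed.

Section Coercive.
Variables (n : nat) (A : 'M[R]_n) (al : R).
Hypothesis al0 : 0 < al.
Hypothesis coercive : forall v, al * vnorm2 v ^+ 2 <= vdot v (A *m v).

(** A row [u] with [u *m A = 0] makes the quadratic form vanish at [u^T], so coercivity gives
    [u = 0]. *)
Lemma coercive_unitmx : A \in unitmx.
Proof.
rewrite -row_free_unit -kermx_eq0; apply/eqP/row_matrixP => i; rewrite row0.
set u := row i _; have uA : u *m A = 0.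
  by rewrite -row_mul mulmx_ker row0.
have := coercive u^T; rewrite /vdot trmxK mulmxA uA mul0mx mxE => h.
have : vnorm2 u^T ^+ 2 <= 0.
  by rewrite -(@pmulr_rle0 _ al).
move=> h0; have /eqP : vnorm2 u^T ^+ 2 == 0 by rewrite eq_le h0 sqr_ge0.
move/eqP; rewrite sqrf_eq0 => /eqP/vnorm2_eq0 /(congr1 trmx).
by rewrite trmxK trmx0.
Qed.

(** For [w = invmx A *m v], coercivity and Cauchy-Schwarz give
    [al * |w|^2 <= <w, v> <= |w| * |v|]. *)
Lemma coercive_invmx v : vnorm2 (invmx A *m v) <= al^-1 * vnorm2 v.
Proof.
set w := invmx A *m v; have Aw : A *m w = v by rewrite mulKVmx// coercive_unitmx.
rewrite mulrC ler_pdivlMr// mulrC.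
have [->|w0] := eqVneq (vnorm2 w) 0; first by rewrite mulr0 vnorm2_ge0.
have wp : 0 < vnorm2 w by rewrite lt_def w0 vnorm2_ge0.
rewrite -(ler_pM2l wp) mulrCA -expr2; apply: le_trans (coercive w) _.
by rewrite Aw; apply: le_trans (ler_norm _) (vdot_le _ _).
Qed.

End Coercive.

Lemma eigenvalueP_vdot n (A : 'M[R]_n) a : eigenvalue A a ->
  exists2 v, vnorm2 v = 1 & vdot v (A *m v) = a.
Proof.
move=> /eigenvalueP[u uA u0]; pose w := u^T.
have w0 : vnorm2 w != 0.
  apply/eqP => /vnorm2_eq0 /(congr1 trmx); rewrite trmxK trmx0.
  by move/eqP; rewrite (negbTE u0).
exists ((vnorm2 w)^-1 *: w).
  by rewrite vnorm2Z normfV ger0_norm ?vnorm2_ge0// mulVf.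
rewrite -scalemxAr vdotZl vdotZr /vdot /w trmxK mulmxA uA -scalemxAl mxE.
have -> : (u *m u^T) 0 0 = vnorm2 u^T ^+ 2 by rewrite sqr_vnorm2 /vdot trmxK.
by rewrite -/w; field.
Qed.

(* If [inf q] over the unit sphere were not an eigenvalue, [A - (inf q) I] would
   be invertible and positive semidefinite, hence coercive. *)
Lemma lambda_min_le n (A : 'M[R]_n) v : A^T = A ->
  lambda_min A * vnorm2 v ^+ 2 <= vdot v (A *m v).
Proof.
move=> symA.
have [->|v0] := eqVneq v 0; first by rewrite vnorm20 expr0n mulr0 mulmx0 /vdot mulmx0 mxE.
have nv0 : vnorm2 v != 0 by apply: contra v0 => /eqP/vnorm2_eq0 ->.
pose E := [set vdot w (A *m w) | w in [set w : 'cV[R]_n | vnorm2 w = 1]].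
have lbE : lbound E (- frob_norm A).
  move=> _ [w w1 <-]; have := vdot_le w (A *m w); have := vnorm2_mulmx A w.
  rewrite w1 mulr1 mul1r => h1 h2.
  by have := le_trans h2 h1; rewrite ler_norml => /andP[].
pose u := (vnorm2 v)^-1 *: v.
have u1 : vnorm2 u = 1 by rewrite vnorm2Z normfV ger0_norm ?vnorm2_ge0// mulVf.
have E0 : E !=set0 by exists (vdot u (A *m u)); exists u.
pose m := inf E.
have has_lbE : has_lbound E by exists (- frob_norm A).
have mE w : vnorm2 w = 1 -> m <= vdot w (A *m w).
  by move=> w1; apply: ge_inf => //; exists w.
have mq w : m * vnorm2 w ^+ 2 <= vdot w (A *m w).
  have [w0|w0] := eqVneq (vnorm2 w) 0.
    by rewrite (vnorm2_eq0 w0) vnorm20 expr0n mulr0 mulmx0 /vdot mulmx0 mxE.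
  have := mE ((vnorm2 w)^-1 *: w).
  rewrite vnorm2Z normfV ger0_norm ?vnorm2_ge0// mulVf// => /(_ erefl).
  rewrite -scalemxAr vdotZl vdotZr mulrA -expr2 exprVn mulrC ler_pdivlMr//.
  by rewrite lt_def sqrf_eq0 w0 sqr_ge0.
pose C := A - m%:M.
have qC w : vdot w (C *m w) = vdot w (A *m w) - m * vnorm2 w ^+ 2.
  by rewrite mulmxBl mul_scalar_mx vdotDr -scaleN1r !vdotZr sqr_vnorm2 mulN1r.
have symC : C^T = C by rewrite linearB /= tr_scalar_mx symA.
pose f := frob_norm C + 1.
have f0 : 0 < f by rewrite ltr_wpDl ?frob_norm_ge0.
(* One gradient step: the form of [C] is nonnegative at [w - f^-1 *: (C *m w)], and [f] dominates
   the norm of [C]. *)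
have Cq w : vnorm2 (C *m w) ^+ 2 <= f * vdot w (C *m w).
  have : 0 <= vdot (w - f^-1 *: (C *m w)) (C *m (w - f^-1 *: (C *m w))).
    by rewrite qC subr_ge0.
  set z := C *m w.
  rewrite mulmxBr -scalemxAr -/z -scaleNr vdotDl !vdotDr.
  rewrite -scaleNr !vdotZl !vdotZr [vdot w (C *m z)]vdot_mulmx symC -/z -sqr_vnorm2.
  have h1 : vdot z (C *m z) <= f * vnorm2 z ^+ 2.
    apply: le_trans (ler_norm _) _; apply: le_trans (vdot_le _ _) _.
    rewrite expr2 mulrCA; apply: ler_wpM2l; first exact: vnorm2_ge0.
    apply: le_trans (vnorm2_mulmx _ _) _; apply: ler_wpM2r; first exact: vnorm2_ge0.
    by rewrite lerDl.
  move: h1; set q := vdot w z; set p := vdot z (C *m z); set s := vnorm2 z ^+ 2.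
  move=> h1 h2.
  have h3 : f^-1 * (f^-1 * p) <= f^-1 * s.
    rewrite ler_pM2l ?invr_gt0//; rewrite mulrC ler_pdivrMr//; lra.
  have : f^-1 * s <= q by lra.
  by rewrite mulrC ler_pdivrMr// mulrC.
have [Cu|nCu] := boolP (C \in unitmx).
  pose c := frob_norm (invmx C) ^+ 2 + 1.
  have c0 : 0 < c by rewrite ltr_wpDl ?sqr_ge0.
  (* On the unit sphere [1 <= c * |C w|^2 <= c * f * <w, C w>], so the infimum [m] could be raised,
     a contradiction. *)
  have : lbound E (m + (c * f)^-1).
    move=> _ [w w1 <-].
    have := vnorm2_mulmx (invmx C) (C *m w); rewrite mulKmx// w1 => h.
    have {}h : 1 <= c * vnorm2 (C *m w) ^+ 2.
      rewrite -[leLHS](expr1n _ 2);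
      apply: (@le_trans _ _ ((frob_norm (invmx C) * vnorm2 (C *m w)) ^+ 2)).
        by rewrite lerXn2r ?nnegrE ?mulr_ge0 ?frob_norm_ge0 ?vnorm2_ge0.
      by rewrite exprMn ler_wpM2r ?sqr_ge0// lerDl.
    have := le_trans h (ler_wpM2l (ltW c0) (Cq w)).
    rewrite qC w1 expr1n mulr1 mulrA => h2.
    have : (c * f)^-1 <= vdot w (A *m w) - m.
      by rewrite -[leLHS]mul1r ler_pdivrMr ?mulr_gt0// mulrC.
    by lra.
  move=> /(lb_le_inf E0); rewrite -/m gerDl leNgt invr_gt0 mulr_gt0//.
have eig : eigenvalue A m.
  move: nCu; rewrite -row_free_unit -kermx_eq0 => /rowV0Pn[x xk x0].
  apply/eigenvalueP; exists x => //.
  move/sub_kermxP: xk; rewrite /C mulmxBr mul_mx_scalar => /eqP.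
  by rewrite subr_eq0 => /eqP.
apply: le_trans (mq v); apply: ler_wpM2r; first exact: sqr_ge0.
(* Every eigenvalue is a value of the form on the unit sphere, so [m] bounds the spectrum below and
   the [inf] is genuine. *)
apply: ge_inf => //; exists m => a /eigenvalueP_vdot[w w1 <-]; exact: mE.
Qed.

End LinearAlgebra.

(** * Predictive and empirical covariances *)

Lemma pred_cov_perturbation (R : realType) (r N N' : nat) (sigma K lam t : R)
  (Phi : 'M[R]_(N', r)) (Sig SigN Sigk : 'M[R]_r) :
  0 < sigma -> (0 < N)%N -> 0 < lam -> 0 <= t -> t <= lam / 2 ->
  frob_norm Phi ^+ 2 <= N'%:R * K ^+ 2 ->
  (forall v, lam * vnorm2 v ^+ 2 <= vdot v (Sig *m v)) ->
  frob_norm (SigN - Sig) <= t -> frob_norm (Sigk - Sig) <= t ->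
  spec_norm (pred_cov N sigma Phi Sigk - pred_cov N sigma Phi SigN) <=
  N'%:R * (K ^+ 2 * (2 * t) / (sigma / N%:R + sigma^-1 * lam / 2) ^+ 2) * N%:R^-1.
Proof.
move=> s0 N0 lam0 t0 tlam PhiK coer hN hk.
have N0' : 0 < N%:R :> R by rewrite ltr0n.
pose c := N%:R / sigma ^+ 2.
have c0 : 0 < c by rewrite divr_gt0 ?exprn_gt0.
pose al := 1 + c * (lam / 2).
have al0 : 0 < al by rewrite ltr_pwDl// mulr_ge0 ?ltW// divr_gt0.
(* A deviation of at most [lam / 2] costs at most half of the coercivity of [Sig]. *)
have coerA S : frob_norm (S - Sig) <= t ->
    forall v, al * vnorm2 v ^+ 2 <= vdot v ((c *: S + 1%:M) *m v).
  move=> hS v; rewrite mulmxDl mul1mx vdotDr -scalemxAl vdotZr -sqr_vnorm2.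
  rewrite -[in S *m v](subrK Sig S) mulmxDl vdotDr.
  have h1 := le_trans (vdot_le v ((S - Sig) *m v))
    (ler_wpM2l (vnorm2_ge0 v) (vnorm2_mulmx (S - Sig) v)).
  have h2 : vnorm2 v * (frob_norm (S - Sig) * vnorm2 v) <= lam / 2 * vnorm2 v ^+ 2.
    rewrite mulrCA -expr2; apply: ler_wpM2r; first exact: sqr_ge0.
    exact: le_trans hS tlam.
  have := le_trans h1 h2; rewrite ler_norml => /andP[h3 _].
  have h4 := coer v.
  have : c * (lam / 2 * vnorm2 v ^+ 2) <=
      c * (vdot v ((S - Sig) *m v) + vdot v (Sig *m v)).
    by rewrite ler_pM2l//; lra.
  by rewrite /al; lra.
set Ak := c *: Sigk + 1%:M; set AN := c *: SigN + 1%:M.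
have uk : Ak \in unitmx by exact: (coercive_unitmx al0 (coerA _ hk)).
have uN : AN \in unitmx by exact: (coercive_unitmx al0 (coerA _ hN)).
have -> : pred_cov N sigma Phi Sigk - pred_cov N sigma Phi SigN =
    Phi *m (invmx Ak *m ((c *: (SigN - Sigk)) *m (invmx AN *m Phi^T))).
  have -> : c *: (SigN - Sigk) = AN - Ak.
    by rewrite /AN /Ak opprD addrACA subrr addr0 scalerBr.
  rewrite mulmxBl mulKVmx// mulmxBr mulKmx// mulmxBr !mulmxA.
  by rewrite -/c.
have hd : frob_norm (SigN - Sigk) <= 2 * t.
  have -> : SigN - Sigk = (SigN - Sig) + - (Sigk - Sig).
    by rewrite opprB addrA subrK.
  by apply: le_trans (frob_normD _ _) _; rewrite frob_normN; lra.
have F0 := frob_norm_ge0 Phi.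
apply: spec_norm_le.
  apply: mulr_ge0; last by rewrite invr_ge0 ltW.
  by rewrite mulr_ge0// divr_ge0 ?sqr_ge0// mulr_ge0 ?sqr_ge0// mulr_ge0.
move=> v; rewrite -!mulmxA.
set w1 := Phi^T *m v; set w2 := invmx AN *m w1.
set w3 := (c *: (SigN - Sigk)) *m w2.
have e1 : vnorm2 w1 <= frob_norm Phi * vnorm2 v.
  by rewrite -(frob_norm_tr Phi); exact: vnorm2_mulmx.
have e2 : vnorm2 w2 <= al^-1 * vnorm2 w1 by exact: (coercive_invmx al0 (coerA _ hN)).
have e3 : vnorm2 w3 <= c * (2 * t) * vnorm2 w2.
  rewrite /w3 -scalemxAl vnorm2Z gtr0_norm// -mulrA ler_pM2l//.
  by apply: le_trans (vnorm2_mulmx _ _) _; apply: ler_wpM2r; rewrite ?vnorm2_ge0.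
have e4 : vnorm2 (invmx Ak *m w3) <= al^-1 * vnorm2 w3.
  exact: (coercive_invmx al0 (coerA _ hk)).
have ai0 : 0 <= al^-1 by rewrite invr_ge0 ltW.
have ct0 : 0 <= c * (2 * t) by apply: mulr_ge0; [exact: ltW|exact: mulr_ge0].
apply: le_trans (vnorm2_mulmx _ _) _.
apply: (le_trans (ler_wpM2l F0 e4)).
apply: (le_trans (ler_wpM2l F0 (ler_wpM2l ai0 e3))).
apply: (le_trans (ler_wpM2l F0 (ler_wpM2l ai0 (ler_wpM2l ct0 e2)))).
apply: (le_trans (ler_wpM2l F0 (ler_wpM2l ai0 (ler_wpM2l ct0 (ler_wpM2l ai0 e1))))).
have -> : frob_norm Phi * (al^-1 * (c * (2 * t) * (al^-1 * (frob_norm Phi * vnorm2 v))))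
    = frob_norm Phi ^+ 2 * (c * (2 * t) * al^-1 ^+ 2 * vnorm2 v) by ring.
have -> : N'%:R * (K ^+ 2 * (2 * t) / (sigma / N%:R + sigma^-1 * lam / 2) ^+ 2) /
    N%:R * vnorm2 v = N'%:R * K ^+ 2 * (c * (2 * t) * al^-1 ^+ 2 * vnorm2 v).
  (* Thus [c / al ^+ 2] is [N%:R^-1] divided by the square of this denominator. *)
  have -> : sigma / N%:R + sigma^-1 * lam / 2 = sigma / N%:R * al.
    by rewrite /al /c; field; rewrite !gt_eqF.
  by rewrite /c; field; rewrite !gt_eqF.
apply: ler_wpM2r => //.
by rewrite mulr_ge0 ?vnorm2_ge0// mulr_ge0// sqr_ge0.
Qed.

Lemma frob_norm_feat_mx (R : realType) (T : Type) (r N' : nat) (K : R)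
  (f : T -> 'cV[R]_r) (xs : 'I_N' -> T) : (forall x, vnorm2 (f x) <= K) ->
  frob_norm (feat_mx f xs) ^+ 2 <= N'%:R * K ^+ 2.
Proof.
move=> fK; rewrite sqr_frob_norm.
have -> : N'%:R * K ^+ 2 = \sum_(i < N') K ^+ 2.
  by rewrite sumr_const card_ord mulr_natl.
apply: ler_sum => i _.
have -> : \sum_j (feat_mx f xs) i j ^+ 2 = vnorm2 (f (xs i)) ^+ 2.
  rewrite sqr_vnorm2 vdotE; apply: eq_bigr => j _; by rewrite mxE expr2.
have K0 := le_trans (vnorm2_ge0 _) (fK (xs i)).
by rewrite lerXn2r ?nnegrE ?vnorm2_ge0.
Qed.

(** The mean [S] is tested against itself: [|S|^2] is the integral of [<S, Y>], at most
    [|S| * M]. *)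
Lemma enorm_mean_le d (T : measurableType d) (R : realType) (Q : probability T R)
  (I : finType) (Y : T -> I -> R) (M : R) :
  (forall i, measurable_fun setT (Y ^~ i)) -> (forall y, enorm (Y y) <= M) ->
  enorm (fun i => \int[Q]_y Y y i) <= M.
Proof.
move=> mY YM; set S := fun i => _.
have M0 : 0 <= M by exact: le_trans (enorm_ge0 _) (YM point).
have iY i := integrable_coord Q mY YM i.
have YE i : (\int[Q]_y (Y y i)%:E = (S i)%:E)%E.
  by rewrite fineK//; exact: integrable_fin_num.
have [->//|S0] := eqVneq (enorm S) 0.
have Sp : 0 < enorm S by rewrite lt_def S0 enorm_ge0.
rewrite -(ler_pM2l Sp) -expr2 sqr_enorm -lee_fin.
have -> : ((dot S S)%:E = \int[Q]_y (\sum_i (S i)%:E * (Y y i)%:E))%E.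
  rewrite integral_sum//; last by move=> i; exact: integrableZl.
  rewrite /dot -sumEFin; apply: eq_bigr => i _.
  by rewrite integralZl// YE EFinM.
apply: (@le_trans _ _ (\int[Q]_y (enorm S * M)%:E)%E).
  apply: le_integral => //.
  - by apply: integrable_sum => // i _; exact: integrableZl.
  - exact: finite_measure_integrable_cst.
  move=> y _; under eq_bigr do rewrite -EFinM.
  rewrite sumEFin lee_fin -[\sum_i _]/(dot S (Y y)).
  apply: le_trans (ler_norm _) _; apply: le_trans (cauchy_schwarz _ _) _.
  by apply: ler_wpM2l; rewrite ?enorm_ge0.
by rewrite integral_cst// [X in (_ * X)%E]probability_setT mule1.
Qed.

(** * Second moments of bounded features *)

Section Features.
Context d (T : measurableType d) (R : realType) (Q : probability T R).
Variables (r : nat) (f : T -> 'cV[R]_r) (K : R).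
Hypothesis mf : forall i, measurable_fun setT (fun x => f x i 0).
Hypothesis fK : forall x, vnorm2 (f x) <= K.

Local Notation Sig := (second_moment Q f).

Let outer (x : T) (p : 'I_r * 'I_r) : R := f x p.1 0 * f x p.2 0.

Definition centered_outer (x : T) (p : 'I_r * 'I_r) : R :=
  f x p.1 0 * f x p.2 0 - Sig p.1 p.2.

Let mouter p : measurable_fun setT (outer^~ p).
Proof. by apply: measurable_funM; exact: mf. Qed.

Let outer_le x : enorm (outer x) <= K ^+ 2.
Proof.
have -> : enorm (outer x) = vnorm2 (f x) ^+ 2.
  apply/eqP; rewrite -(@eqrXn2 _ 2)// ?enorm_ge0 ?sqr_ge0//.
  rewrite sqr_enorm sqr_vnorm2 vdotE expr2 /dot mulr_suml.
  under [in eqbRHS]eq_bigr do rewrite mulr_sumr.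
  rewrite pair_bigA /=; apply/eqP; apply: eq_bigr => p _; rewrite /outer; ring.
by rewrite lerXn2r ?nnegrE ?vnorm2_ge0// (le_trans (vnorm2_ge0 _) (fK x)).
Qed.

Lemma frob_norm_second_moment : frob_norm Sig <= K ^+ 2.
Proof.
have := enorm_mean_le Q mouter outer_le.
by congr (_ <= _); congr enorm; apply/funext => p; rewrite mxE.
Qed.

Lemma second_moment_sym : Sig^T = Sig.
Proof.
apply/matrixP => i j; rewrite !mxE; apply: eq_Rintegral => x _; exact: mulrC.
Qed.

Lemma measurable_centered_outer p : measurable_fun setT (centered_outer^~ p).
Proof. by apply: measurable_funB => //; exact: mouter. Qed.

Lemma centered_outer_le x : enorm (centered_outer x) <= 2 * K ^+ 2.
Proof.
have -> : enorm (centered_outer x) = frob_norm (f x *m (f x)^T - Sig).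
  congr enorm; apply/funext => p; rewrite !mxE big_ord1 /centered_outer.
  by rewrite !mxE.
apply: le_trans (frob_normD _ _) _; rewrite frob_normN.
have : frob_norm (f x *m (f x)^T) <= K ^+ 2.
  apply: le_trans (outer_le x); rewrite le_eqVlt; apply/orP; left; apply/eqP.
  by congr enorm; apply/funext => p; rewrite !mxE big_ord1 !mxE.
have := frob_norm_second_moment; lra.
Qed.

Lemma centered_outer_mean p : (\int[Q]_x (centered_outer x p)%:E = 0)%E.
Proof.
have iY := integrable_coord Q mouter outer_le p.
under eq_integral do rewrite EFinB.
rewrite integralB//; last exact: finite_measure_integrable_cst.
rewrite integral_cst// [X in (_ - _ * X)%E]probability_setT mule1 mxE.
by rewrite fineK ?subee//; exact: integrable_fin_num.
Qed.

Lemma emp_cov_centered n (xs : 'I_n -> T) : (0 < n)%N ->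
  n%:R * frob_norm (emp_cov f xs - Sig) =
  enorm (fun p => \sum_j centered_outer (xs j) p).
Proof.
move=> n0; have n0' : 0 < n%:R :> R by rewrite ltr0n.
apply/eqP; rewrite -(@eqrXn2 _ 2)// ?mulr_ge0 ?ler0n ?enorm_ge0//.
rewrite exprMn !sqr_enorm /dot mulr_sumr; apply/eqP; apply: eq_bigr => p _.
rewrite -[X in _ = X]expr2 -[X in _ * X]expr2 -exprMn; congr (_ ^+ 2).
rewrite !mxE mulrBr mulrA divff ?gt_eqF// mul1r summxE /centered_outer sumrB.
rewrite sumr_const card_ord mulr_natl; congr (_ - _).
  by apply: eq_bigr => j _; rewrite mxE big_ord1 !mxE.
by rewrite mxE.
Qed.

Lemma lambda_min_second_moment_le v :
  lambda_min Sig * vnorm2 v ^+ 2 <= vdot v (Sig *m v).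
Proof. by apply: lambda_min_le; exact: second_moment_sym. Qed.

Hypothesis lam0 : 0 < lambda_min Sig.

(** For [r = 0] there are no eigenvalues and the [inf] is 0, against [lam0]. *)
Lemma lambda_min_dim : (0 < r)%N.
Proof.
rewrite lt0n; apply/eqP => r0.
have : [set a : R | eigenvalue Sig a] = set0.
  apply/seteqP; split => // a /= /eigenvalueP_vdot[v v1 _].
  move: v1; rewrite /vnorm2 big1 ?sqrtr0; first by move/eqP; rewrite eq_sym oner_eq0.
  by move=> i _; exfalso; move: (ltn_ord i); rewrite [X in (_ < X)%N]r0.
by move=> e; move: lam0; rewrite /lambda_min e inf0 ltxx.
Qed.

(** The quadratic form is evaluated at a basis vector. This later forces [K] to be positive. *)
Lemma lambda_min_le_bound : lambda_min Sig <= K ^+ 2.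
Proof.
pose v : 'cV[R]_r := delta_mx (Ordinal lambda_min_dim) 0.
have v1 : vnorm2 v = 1.
  rewrite /vnorm2 (bigD1 (Ordinal lambda_min_dim))//= big1.
    by rewrite mxE !eqxx expr1n addr0 sqrtr1.
  by move=> i /negbTE i0; rewrite mxE i0 expr0n.
have := lambda_min_second_moment_le v; rewrite v1 expr1n mulr1 => h.
apply: le_trans h _; apply: le_trans (ler_norm _) _.
apply: le_trans (vdot_le _ _) _; rewrite v1 mul1r.
by apply: le_trans (vnorm2_mulmx _ _) _; rewrite v1 mulr1 frob_norm_second_moment.
Qed.

End Features.

(** * Tail bounds for samples and subsamples *)

Lemma sum_injective_codom (R : pzRingType) (I J : finType) (g : I -> J)
  (h : J -> R) : injective g ->
  \sum_i h (g i) = \sum_j (j \in g @: I)%:R * h j.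
Proof.
move=> ginj; under [RHS]eq_bigr do rewrite -mulr_natl mulr1 mulr_natl mulrb.
by rewrite -big_mkcond big_imset//; exact: in2W.
Qed.

Lemma measure_big_setU_le d (T : measurableType d) (R : realType)
  (mu : {measure set T -> \bar R}) (I : Type) (s : seq I) (F : I -> set T) :
  (forall i, measurable (F i)) ->
  (mu (\big[setU/set0]_(i <- s) F i) <= \sum_(i <- s) mu (F i))%E.
Proof.
move=> mF; elim: s => [|i s IH]; first by rewrite !big_nil measure0.
rewrite !big_cons; apply: le_trans (measureU2 _ _ _) _ => //.
  exact: bigsetU_measurable.
exact: leeD.
Qed.

Section Sampling.
Context d (T : measurableType d) (R : realType) (Q : probability T R).
Context dO (Omega : measurableType dO) (P : probability Omega R).
Variables (r N : nat) (f : T -> 'cV[R]_r) (K : R) (U : finType).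
Variables (X : 'I_N -> Omega -> T) (S : Omega -> U).
Hypothesis mf : forall i, measurable_fun setT (fun x => f x i 0).
Hypothesis fK : forall x, vnorm2 (f x) <= K.
Hypothesis K0 : 0 < K.
Hypothesis mX : forall i, measurable_fun setT (X i).
Hypothesis lawX : forall i A, measurable A -> P (X i @^-1` A) = Q A.
Hypothesis mS : forall B, measurable (S @^-1` B).
Hypothesis indep : mutually_independent P X S.

Definition deviation (c : 'I_N -> R) (w : Omega) : R :=
  enorm (fun p => \sum_j c j * centered_outer Q f (X j w) p).

Lemma measurable_deviation_ge c s : measurable [set w | s <= deviation c w].
Proof.
rewrite (_ : [set w | _] = (fun w => s <= deviation c w) @^-1` [set true])//.
rewrite -[X in measurable X]setTI; apply: measurable_fun_ler => //.
apply: measurable_enorm => p; apply: measurable_sum => j.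
apply: measurable_funM => //.
by apply: (measurableT_comp (measurable_centered_outer Q mf p)).
Qed.

Lemma deviation_tail (c : 'I_N -> R) (n : nat) (t e : R) (B : set U) :
  (forall j, 0 <= c j) -> (0 < n)%N -> \sum_j c j ^+ 2 = n%:R -> 0 <= t ->
  2 * expR (- (n%:R * t ^+ 2 / (8 * K ^+ 4))) <= e ->
  (P ([set w | (n%:R * t <= deviation c w)%R] `&` S @^-1` B) <=
   e%:E * P (S @^-1` B))%E.
Proof.
move=> c0 n0 cn t0 he.
have n0' : 0 < n%:R :> R by rewrite ltr0n.
pose mu := mrestr P (mS B).
have indep_mu A : (forall i, measurable (A i)) ->
    (mu (\bigcap_(i in [set: 'I_N]) X i @^-1` A i) =
     (\prod_(i < N) Q (A i)) * mu setT)%E.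
  move=> mA; rewrite /mu /mrestr setTI indep//; congr (_ * _)%E.
  by apply: eq_bigr => i _; rewrite lawX.
have B0 : 0 < 2 * K ^+ 2 by rewrite mulr_gt0 ?exprn_gt0.
have s0 : 0 <= n%:R * t by rewrite mulr_ge0 ?ler0n.
have V0 : 0 < \sum_j c j ^+ 2 by rewrite cn.
have := @hilbert_hoeffding _ _ _ _ _ mu Q N X mX indep_mu _ (centered_outer Q f)
  (2 * K ^+ 2) c (measurable_centered_outer Q mf) (centered_outer_le Q mf fK)
  (centered_outer_mean Q mf fK) c0 _ B0 s0 V0.
have muT : mu setT = P (S @^-1` B) by congr (P _); exact: setTI.
move=> h; apply: le_trans h _; rewrite cn [X in (_ * X <= _)%E]muT.
apply: lee_wpmul2r => //; rewrite lee_fin; apply: le_trans he.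
rewrite ler_pM2l// ler_expR lerN2 le_eqVlt; apply/orP; left; apply/eqP.
by field; rewrite !gt_eqF.
Qed.

End Sampling.

(** An upper bound is all that the union bound over selections requires. *)
Lemma uniform_without_replacement_sum_le (R : realType) (dO : measure_display)
  (Omega : measurableType dO) (P : probability Omega R) (N k : nat)
  (S : Omega -> {ffun 'I_k -> 'I_N}) : uniform_without_replacement P S ->
  (\sum_g P (S @^-1` [set g]) <= 1)%E.
Proof.
move=> [_ unifS]; under eq_bigr do rewrite unifS; rewrite sumEFin lee_fin.
rewrite -big_mkcond sumr_const.
set m := #|[set g : {ffun 'I_k -> 'I_N} | injectiveb g]|.
rewrite [X in _ *+ X](_ : _ = m); last first.
  by apply: eq_card => g; apply/idP/idP; rewrite !inE.
have [->|m0] := eqVneq m 0%N; first by rewrite mulr0n.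
by rewrite -[leLHS]mulr_natr mulVf// pnatr_eq0.
Qed.

(** * The subsampling error bound *)

Theorem theoremA4 (R : realType) (d r : nat)
  (PX : probability (Rd R d) R)
  (phi : Rd R d -> 'cV[R]_r) (L : 'M[R]_r)
  (sigma K delta : R) (N k : nat)
  (dO : measure_display) (Omega : measurableType dO)
  (P : probability Omega R)
  (X : 'I_N -> Omega -> Rd R d) (S : Omega -> {ffun 'I_k -> 'I_N}) :
  0 < sigma ->
  (forall i : 'I_r, measurable_fun setT (fun x => phiL L phi x i 0)) ->
  (forall x, vnorm2 (phiL L phi x) <= K) ->
  0 < lambda_min (second_moment PX (phiL L phi)) ->
  0 < delta ->
  (k <= N)%N ->
  8 / 3 * ln (4 * r%:R / delta) *
    (4 * K ^+ 2 / lambda_min (second_moment PX (phiL L phi))) ^+ 2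
    <= k%:R ->
  (forall i, measurable_fun setT (X i)) ->
  (forall i A, measurable A -> P (X i @^-1` A) = PX A) ->
  uniform_without_replacement P S ->
  mutually_independent P X S ->
  exists E : set Omega,
    [/\ measurable E, ((1 - delta)%:E <= P E)%E &
     forall omega, E omega ->
     forall (N' : nat) (xt : 'I_N' -> Rd R d),
       let Phi := feat_mx (phiL L phi) xt in
       let SigN := emp_cov (phiL L phi) (fun i => X i omega) in
       let Sigk := emp_cov (phiL L phi) (fun i => X (S omega i) omega) in
       let lam := lambda_min (second_moment PX (phiL L phi)) in
       spec_norm (pred_cov N sigma Phi Sigk - pred_cov N sigma Phi SigN)
       <= N'%:R * (4 * K ^+ 4 / (sigma / N%:R + sigma^-1 * lam / 2) ^+ 2)
          * N%:R^-1 * Num.sqrt (8 / (3 * k%:R) * ln (4 * r%:R / delta))].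
Proof.
move=> sig0 mf fK lam0 del0 kN hk mX lawX unifS indep.
set f := phiL L phi in mf fK lam0 hk *.
set lam := lambda_min (second_moment PX f) in lam0 hk *.
(* For [delta >= 1] the empty event will do; otherwise [4 * r%:R / delta > 1] and the logarithm is
   positive. *)
have [del1|del1] := leP 1 delta.
  exists set0; split=> //; rewrite measure0 lee_fin; lra.
have r0 : (0 < r)%N by exact: lambda_min_dim lam0.
have r1 : 1 <= r%:R :> R by rewrite ler1n.
have lamK : lam <= K ^+ 2 by exact: (lambda_min_le_bound mf fK lam0).
have Kge0 : 0 <= K by exact: le_trans (vnorm2_ge0 _) (fK point).
have K0 : 0 < K.
  rewrite lt_def Kge0 andbT; apply/eqP => Ke.
  by move: (lt_le_trans lam0 lamK); rewrite Ke expr0n ltxx.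
set l := ln (4 * r%:R / delta) in hk *.
have q0 : 0 < 4 * r%:R / delta by rewrite divr_gt0// mulr_gt0// ltr0n.
have l0 : 0 < l.
  apply: ln_gt0; rewrite ltr_pdivlMr// mul1r; lra.
have k0 : (0 < k)%N.
  rewrite -(ltr0n R); apply: lt_le_trans hk.
  apply: mulr_gt0; first by rewrite mulr_gt0.
  by rewrite exprn_gt0// divr_gt0// mulr_gt0// exprn_gt0.
have N0 : (0 < N)%N by exact: leq_trans kN.
have k0' : 0 < k%:R :> R by rewrite ltr0n.
have kN' : k%:R <= N%:R :> R by rewrite ler_nat.
set eps := Num.sqrt (8 / (3 * k%:R) * l).
have eps0 : 0 <= eps by exact: sqrtr_ge0.
have eps2 : eps ^+ 2 = 8 / (3 * k%:R) * l.
  by rewrite sqr_sqrtr// mulr_ge0 ?ltW// divr_gt0 ?mulr_gt0.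
pose t := 2 * K ^+ 2 * eps.
have t0 : 0 <= t by rewrite mulr_ge0// mulr_ge0 ?sqr_ge0.
(* Equivalently [eps <= lam / (4 * K ^+ 2)], which is the lower bound on [k] after squaring. *)
have tlam : t <= lam / 2.
  suff : eps <= lam / (4 * K ^+ 2).
    rewrite ler_pdivlMr ?mulr_gt0 ?exprn_gt0// /t; lra.
  have x0 : 0 <= lam / (4 * K ^+ 2).
    by rewrite divr_ge0 ?mulr_ge0 ?sqr_ge0// ltW.
  rewrite -(@ler_pXn2r _ 2)// eps2.
  have xe : 4 * K ^+ 2 / lam = (lam / (4 * K ^+ 2))^-1 by rewrite invf_div.
  have xp : 0 < (lam / (4 * K ^+ 2)) ^+ 2.
    by rewrite exprn_gt0// divr_gt0// mulr_gt0// exprn_gt0.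
  move: hk; rewrite xe exprVn ler_pdivrMr// => hk.
  rewrite (_ : 8 / (3 * k%:R) * l = 8 / 3 * l / k%:R); last first.
    by field; rewrite gt_eqF.
  by rewrite ler_pdivrMr// [leRHS]mulrC.
(* The exponent equals [4 / 3 * (n / k) * l], at least [l], so the tail is at most
   [2 * delta / (4 * r)]. It serves for [n = N] and [n = k]. *)
have tail n : (k <= n)%N ->
    2 * expR (- (n%:R * t ^+ 2 / (8 * K ^+ 4))) <= delta / 2.
  move=> kn; have kn' : k%:R <= n%:R :> R by rewrite ler_nat.
  have : expR (- (n%:R * t ^+ 2 / (8 * K ^+ 4))) <= delta / (4 * r%:R).
    rewrite -[leRHS]invf_div -[in leRHS](lnK q0) -expRN ler_expR lerN2 -/l.
    have -> : n%:R * t ^+ 2 / (8 * K ^+ 4) = 4 / 3 * (n%:R / k%:R) * l.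
      rewrite /t !exprMn eps2; field; rewrite !gt_eqF//.
    have : 1 <= n%:R / k%:R :> R by rewrite ler_pdivlMr// mul1r.
    move=> /(ler_wpM2r (ltW l0)) h; lra.
  move=> h; apply: le_trans (ler_wpM2l _ h) _ => //.
  rewrite mulrA ler_pdivrMr; last by rewrite mulr_gt0// ltr0n.
  have := ler_wpM2l (ltW del0) r1; lra.
have [mS unif] := unifS.
pose one : 'I_N -> R := fun=> 1.
(* For injective [g] no index repeats, so the subsample sum is a sum over all of ['I_N] with these
   0/1 weights, whose squares add up to [k]. *)
pose ind (g : {ffun 'I_k -> 'I_N}) (j : 'I_N) : R := (j \in g @: 'I_k)%:R.
pose bad1 := [set w | N%:R * t <= deviation PX f X one w] `&` S @^-1` setT.
(* A non-injective selection has probability zero, so it may count as bad. *)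
pose bad2 (g : {ffun 'I_k -> 'I_N}) :=
  (if injectiveb g then [set w | k%:R * t <= deviation PX f X (ind g) w]
   else setT) `&` S @^-1` [set g].
have mbad1 : measurable bad1.
  by apply: measurableI => //; exact: measurable_deviation_ge.
have mbad2 g : measurable (bad2 g).
  by apply: measurableI => //; case: ifP => // _; exact: measurable_deviation_ge.
have Pbad1 : (P bad1 <= (delta / 2)%:E)%E.
  apply: le_trans (deviation_tail mf fK K0 mX lawX mS indep (e := delta / 2) setT
    _ N0 _ t0 _) _ => //.
  - by rewrite /one; under eq_bigr do rewrite expr1n; rewrite sumr_const card_ord.
  - exact: tail.
  by rewrite preimage_setT [X in (_ * X)%E]probability_setT mule1.
have Pbad2 g : (P (bad2 g) <= (delta / 2)%:E * P (S @^-1` [set g]))%E.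
  rewrite /bad2; case: ifP => [/injectiveP ginj|ginj].
    apply: (deviation_tail mf fK K0 mX lawX mS indep) => //.
    - transitivity (\sum_(i < k) (1 : R)); last by rewrite sumr_const card_ord.
      rewrite (sum_injective_codom (fun=> 1) ginj).
      by apply: eq_bigr => j _; rewrite /ind mulr1; case: (_ \in _); rewrite ?expr1n ?expr0n.
    - exact: tail.
  by rewrite setTI unif ginj mule0.
pose Bad := bad1 `|` \big[setU/set0]_g bad2 g.
have mU : measurable (\big[setU/set0]_g bad2 g) by exact: bigsetU_measurable.
have mBad : measurable Bad by exact: measurableU.
exists (~` Bad); split; first exact: measurableC.
  rewrite probability_setC// EFinB leeB//.
  apply: le_trans (measureU2 _ _ _) _ => //.
  have -> : delta%:E = ((delta / 2)%:E + (delta / 2)%:E)%E.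
    by rewrite -EFinD; congr (_%:E); field.
  apply: leeD => //; apply: le_trans (measure_big_setU_le _ _ mbad2) _.
  apply: le_trans; first by apply: lee_sum => g _; exact: Pbad2.
  rewrite -ge0_sume_distrr//.
  rewrite -[leRHS]mule1; apply: lee_wpmul2l; first by rewrite lee_fin divr_ge0// ltW.
  exact: uniform_without_replacement_sum_le.
(* The rest is deterministic: [Bad] was fixed before the test points, which enter only through the
   norm of their feature matrix. *)
move=> w /= nbad N' xt.
have nbad1 : frob_norm (emp_cov f (X^~ w) - second_moment PX f) <= t.
  rewrite leNgt; apply/negP => h; apply: nbad; left; split => //=.
  rewrite /deviation.
  have -> : (fun p => \sum_j one j * centered_outer PX f (X j w) p) =
      (fun p => \sum_j centered_outer PX f (X j w) p).
    by apply/funext => p; apply: eq_bigr => j _; rewrite mul1r.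
  by rewrite -emp_cov_centered// ler_pM2l ?ltr0n// ltW.
have nbad2 : frob_norm (emp_cov f (fun i => X (S w i) w) - second_moment PX f) <= t.
  rewrite leNgt; apply/negP => h; apply: nbad; right.
  rewrite -bigcup_seq; exists (S w); first by rewrite /= mem_index_enum.
  split => //; case: ifP => [/injectiveP ginj|//] /=; rewrite /deviation.
  have -> : (fun p => \sum_j ind (S w) j * centered_outer PX f (X j w) p) =
      (fun p => \sum_j centered_outer PX f (X (S w j) w) p).
    apply/funext => p.
    by rewrite (sum_injective_codom (fun j => centered_outer PX f (X j w) p) ginj).
  by rewrite -emp_cov_centered// ler_pM2l// ltW.
apply: le_trans (pred_cov_perturbation sig0 N0 lam0 t0 tlam
  (frob_norm_feat_mx xt fK) (lambda_min_second_moment_le PX f) nbad1 nbad2) _.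
rewrite le_eqVlt; apply/orP; left; apply/eqP.
rewrite /t -/eps.
have : (sigma / N%:R + sigma^-1 * lam / 2) ^+ 2 != 0.
  rewrite sqrf_eq0 gt_eqF// addr_gt0 ?divr_gt0 ?ltr0n// mulr_gt0 ?invr_gt0//.
move: (_ ^+ 2) => D D0; field; rewrite D0 andbT gt_eqF// ltr0n//.
Qed.
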